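(* Let $V$ be a vertex operator algebra, fix $n\in\mathbb{Z}_+$, and let $u\in V$ have weight $\mathrm{wt}\,u\ge -n$ such that $V^u=\langle u\rangle^1$ satisfies the permutation property and acts strongly on a subset $W\subset V$ consisting of homogeneous vectors. Then: (1) $A_n^u$ is generated by the elements $u_{-2n}^{i_{2n}}u_{-2n+1}^{i_{2n-1}}\cdots u_{-1}^{i_1}\mathbf{1}+O_n(V)$, $i_1,\dots,i_{2n}\in\mathbb{N}$, and every element of $A_n^u.W$ is a linear combination of elements $u_{-2n}^{i_{2n}}\cdots u_{-1}^{i_1}v_{-k}\mathbf{1}+O_n(V)$ with $v\in W$, $k\in\mathbb{Z}_+$, $i_j\in\mathbb{N}$. (2) For $v\in W$ and $k\in\mathbb{Z}_+$, \[ u_{-2n-1}v_{-k}\mathbf{1}\approx-\Big(\frac{\mathrm{wt}\,u+\mathrm{wt}\,v+2n+k-2}{2n}\Big)u_{-2n}v_{-k}\mathbf{1}-\frac{k}{2n}u_{-2n}v_{-k-1}\mathbf{1}. \] (3) For $v\in W$, $i_1,\dots,i_{2n}\in\mathbb{N}$ and $i_{2n+1},k\in\mathbb{Z}_+$, set $N=i_1+\cdots+i_{2n+1}$, $M=u_{-2n-1}^{i_{2n+1}-1}u_{-2n}^{i_{2n}+1}u_{-2n+1}^{i_{2n-1}}\cdots u_{-1}^{i_1}$, and for $1\le l\le 2n-1$ let $M^{(l)}$ be the monomial obtained from $M$ by raising the exponent of $u_{-l-1}$ by one and lowering the exponent of $u_{-l}$ by one. Let $D=\sum_{j=1}^{n+\mathrm{wt}\,u}\binom{n+\mathrm{wt}\,u}{j-1}u_{\mathrm{wt}\,u-n-j-1}$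 (so $D=0$ if $\mathrm{wt}\,u=-n$). Then \begin{multline*} u_{-2n-1}^{i_{2n+1}}u_{-2n}^{i_{2n}}\cdots u_{-1}^{i_1}v_{-k}\mathbf{1}\equiv_n-\frac{1}{2n(i_{2n}+1)}\Bigg(\Big(\mathrm{wt}(v_{-k}\mathbf{1})-1+\sum_{j=1}^{2n+1}i_j(\mathrm{wt}\,u+j-1)\Big)Mv_{-k}\mathbf{1}\\ -(2n+1)(i_{2n+1}-1)\,D\,u_{-2n-1}^{i_{2n+1}-2}u_{-2n}^{i_{2n}+1}u_{-2n+1}^{i_{2n-1}}\cdots u_{-1}^{i_1}v_{-k}\mathbf{1}+\sum_{l=1}^{2n-1}l\,i_l\,M^{(l)}v_{-k}\mathbf{1}+k\,Mv_{-k-1}\mathbf{1}+f\Bigg) \end{multline*} for some $f\in F_{N-1}(v_{-k}\mathbf{1})$ (the term containing $D$ is absent when $i_{2n+1}=1$, since its coefficient vanishes), and $f=0$ if the operators $u_{-j}$, $j\in\mathbb{Z}_+$, pairwise commute.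
   Context: $V$ has vacuum $\mathbf{1}$, modes $Y(v,x)=\sum v_kx^{-k-1}$, Virasoro operators $L(m)$, weights $\mathrm{wt}$ ($L(0)$-eigenvalues; $\mathrm{wt}(v_{-k}\mathbf{1})=\mathrm{wt}\,v+k-1$). For homogeneous $a$, $a\circ_nb=\mathrm{Res}_x(1+x)^{\mathrm{wt}\,a+n}Y(a,x)b\,x^{-2n-2}$; $O_n^\circ(V)=\mathrm{span}\{a\circ_nb\}$, $O^L(V)=\{(L(-1)+L(0))v\}$, $O_n(V)=O^L(V)+O_n^\circ(V)$, $A_n(V)=V/O_n(V)$ the level $n$ Zhu algebra with product $a*_nb=\sum_{m=0}^n(-1)^m\binom{m+n}{n}\mathrm{Res}_x(1+x)^{\mathrm{wt}\,a+n}Y(a,x)b\,x^{-n-m-1}$. $a\approx b$ means $a-b\in O^L(V)$; $a\equiv_nb$ means $a-b\in O_n(V)$. $V^u=\langle u\rangle^1$ is the span of all $u_{-k_1}\cdots u_{-k_r}\mathbf{1}$ ($k_i\in\mathbb{Z}_+$), assumed a vertex subalgebra. $F_r(w)$ is the span of $u_{-k_1}\cdots u_{-k_p}w$ with $p\le r$, $k_i\ge1$. Permutation property on $W$: for all $m\in\mathbb{Z}_+$, permutations $\sigma$, $u^{(i)}\in V^u$, $w\in W$, $k_i\in\mathbb{Z}$: $u^{(1)}_{-k_1}\cdots u^{(m)}_{-k_m}w-u^{(\sigma(1))}_{-k_{\sigma(1)}}\cdots u^{(\sigma(m))}_{-k_{\sigma(m)}}w\in F_{m-1}(w)$; ''satisfies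 the permutation property'' means this for $W=V^u$. Acting strongly on $W$: permutation property on $W$ and $a_jw=0$ for all $a\in V^u$, $w\in W$, $j\ge0$. $A_n^u$ is the subalgebra of $A_n(V)$ generated by $V^u+O_n(V)$; $A_n^u.W$ is the set of $u_{-k_1}\cdots u_{-k_m}v+O_n(V)$, $v\in W$, $k_i\in\mathbb{Z}_+$. Binomials $\binom{p}{q}=p(p-1)\cdots(p-q+1)/q!$ for $q\in\mathbb{N}$. *)

(* Defs.v *)
From HB Require Import structures.
From Stdlib Require Import List.
From mathcomp Require Import all_boot all_order all_algebra.
Set Implicit Arguments. Unset Strict Implicit. Unset Printing Implicit Defensive.
Import Order.TTheory GRing.Theory Num.Theory.
Local Open Scope ring_scope.

Definition binz {K : fieldType} (p : int) (q : nat) : K :=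
  (\prod_(j < q) ((p - (j : nat)%:Z)%:~R : K)) / (q`!)%:R.

Section VOADefs.
Variables (K : fieldType) (V : lmodType K).
(* Y a k b  is the mode  a_k b  (Y(a,x) = sum_k a_k x^(-k-1)) *)
Variable Y : V -> int -> V -> V.
Variables (vac omega : V) (cc : K).

Definition Lop (m : int) (v : V) : V := Y omega (m + 1) v.
Definition homog (v : V) (w : int) : Prop := Lop 0 v = w%:~R *: v.

Definition inspan (P : V -> Prop) (x : V) : Prop :=
  exists s : seq (K * V), List.Forall (fun p => P p.2) s /\
    x = \sum_(p <- s) p.1 *: p.2.

Record isVOA : Prop := {
  Y_linl : forall a b c k (x : K), Y (x *: a + b) k c = x *: Y a k c + Y b k c;
  Y_linr : forall a b c k (x : K), Y a k (x *: b + c) = x *: Y a k b + Y a k c;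
  grading : forall v, exists s : seq (int * V),
      List.Forall (fun p => homog p.2 p.1) s /\ v = \sum_(p <- s) p.2;
  fin_dim : forall n : int, exists s : seq V,
      forall v, homog v n -> inspan (fun y => List.In y s) v;
  lower_bd : exists N : int, forall (n : int) v, n < N -> homog v n -> v = 0;
  truncation : forall a b, exists N : int, forall k, N <= k -> Y a k b = 0;
  vacuum_id : forall k b, Y vac k b = if k == -1 then b else 0;
  creation0 : forall a k, 0 <= k -> Y a k vac = 0;
  creation1 : forall a, Y a (-1) vac = a;
  (* Jacobi identity in Borcherds' component form (all sums are finite) *)
  borcherds : forall a b c (l m n : int), exists N, forall N', (N <= N')%N ->
     \sum_(i < N') binz m i *: Y (Y a (l + (i : nat)%:Z) b) (m + n - (i : nat)%:Z) c =
     \sum_(i < N') ((-1) ^+ i * binz l i) *: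
        (Y a (l + m - (i : nat)%:Z) (Y b (n + (i : nat)%:Z) c)
         - (-1) ^+ `|l|%N *: Y b (l + n - (i : nat)%:Z) (Y a (m + (i : nat)%:Z) c));
  virasoro : forall (m k : int) v,
     Lop m (Lop k v) - Lop k (Lop m v) =
       (m - k)%:~R *: Lop (m + k) v
       + ((if m + k == 0 then ((m ^+ 3 - m)%:~R / 12%:R) * cc else 0) *: v);
  omega_wt : homog omega 2;
  L_deriv : forall a k b, Y (Lop (-1) a) k b = (- k)%:~R *: Y a (k - 1) b
}.

Definition isRes (f : nat -> V) (y : V) : Prop :=
  exists N, forall N', (N <= N')%N -> \sum_(i < N') f i = y.

(* a o_n b = Res_x (1+x)^(wt a + n) Y(a,x) b x^(-2n-2), for a of weight wa *)
Definition circ_hom (n : nat) (a : V) (wa : int) (b : V) (y : V) : Prop :=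
  isRes (fun i => binz (wa + n%:Z) i *: Y a ((i : nat)%:Z - (2 * n)%:Z - 2) b) y.

Definition Ocirc (n : nat) (x : V) : Prop :=
  inspan (fun y => exists a wa b, homog a wa /\ circ_hom n a wa b y) x.

Definition OL (x : V) : Prop := exists v, x = Lop (-1) v + Lop 0 v.

Definition On (n : nat) (x : V) : Prop :=
  exists y z, OL y /\ Ocirc n z /\ x = y + z.

Definition star_hom (n : nat) (a : V) (wa : int) (b : V) (y : V) : Prop :=
  isRes (fun i => \sum_(m < n.+1)
     ((-1) ^+ m * ('C(m + n, n))%:R * binz (wa + n%:Z) i) *:
       Y a ((i : nat)%:Z - n%:Z - (m : nat)%:Z - 1) b) y.

Definition star_rel (n : nat) (a b y : V) : Prop :=
  exists s : seq ((int * V) * V),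
    List.Forall (fun t => homog t.1.2 t.1.1 /\ star_hom n t.1.2 t.1.1 b t.2) s /\
    a = \sum_(t <- s) t.1.2 /\ y = \sum_(t <- s) t.2.

(* preimage in V of the subalgebra of A_n(V) = V/O_n(V) generated by
   the classes of the elements of S *)
Inductive gen_alg (n : nat) (S : V -> Prop) : V -> Prop :=
 | ga_gen x : S x -> gen_alg n S x
 | ga_On x : On n x -> gen_alg n S x
 | ga_lin (c : K) x y : gen_alg n S x -> gen_alg n S y -> gen_alg n S (c *: x + y)
 | ga_mul a b y : gen_alg n S a -> gen_alg n S b -> star_rel n a b y -> gen_alg n S y.

Definition umon (u : V) (ks : seq nat) (w : V) : V :=
  foldr (fun k x => Y u (- (k%:Z)) x) w ks.

Definition Vgen (u : V) (x : V) : Prop :=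
  inspan (fun y => exists ks, all (fun k => 0 < k)%N ks /\ y = umon u ks vac) x.

Definition Fr (u : V) (r : nat) (w : V) (x : V) : Prop :=
  inspan (fun y => exists ks, (size ks <= r)%N /\ all (fun k => 0 < k)%N ks /\
                            y = umon u ks w) x.

Definition gmon (s : seq (V * int)) (w : V) : V :=
  foldr (fun p x => Y p.1 (- p.2) x) w s.

Definition perm_prop (u : V) (W : V -> Prop) : Prop :=
  forall (s t : seq (V * int)) (w : V), (0 < size s)%N -> perm_eq s t ->
    List.Forall (fun p => Vgen u p.1) s -> W w ->
    Fr u (size s).-1 w (gmon s w - gmon t w).

Definition acts_strongly (u : V) (W : V -> Prop) : Prop :=
  perm_prop u W /\ (forall a w (j : int), Vgen u a -> W w -> 0 <= j -> Y a j w = 0).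

Definition vsubalg (u : V) : Prop :=
  forall a b k, Vgen u a -> Vgen u b -> Vgen u (Y a k b).

Fixpoint om (u : V) (j : nat) (e : nat -> nat) (w : V) : V :=
  match j with
  | 0 => w
  | j'.+1 => iter (e j'.+1) (Y u (- (j'.+1)%:Z)) (om u j' e w)
  end.

End VOADefs.

(* Main.v *)
(* The modes of any [v] annihilated by the nonnegative modes of [u] commute with
   the modes of [u].  Hence a monomial [u_{-k_1} ... u_{-k_r}] applied to
   [v_{-k} 1] is [v_{-k}] applied to [u_{-k_1} ... u_{-k_r} 1], and it can be
   reordered modulo shorter monomials.  Parts (2) and (3) apply [L(-1) + L(0)] to
   a monomial, the derivation [L(-1)] raising one index at a time; the resulting
   [u_{-2n-2}] equals [-D] modulo [u o_n b].  For part (1), a factor [u_{-m}] with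
   [m >= 2n+2] is the leading term of [(L(-1)^t u) o_n b], and a factor
   [u_{-2n-1}] is removed by [L(-1) + L(0)]; the induction is lexicographic on the
   length of the monomial, the sum of its indices, and its number of
   [u_{-2n-1}]. *)
Require Import Defs.
From HB Require Import structures.
From Stdlib Require Import List.
From mathcomp Require Import all_boot all_order all_algebra.
From mathcomp Require Import zify ring.
Import Order.TTheory GRing.Theory Num.Theory.
Local Open Scope ring_scope.

(** * Binomials, and index lists versus exponent functions *)

Section Preliminaries.
Set Implicit Arguments.
Unset Strict Implicit.

Lemma binz_nat (K : fieldType) (m q : nat) :
  [pchar K] =i pred0 -> binz m%:Z q = 'C(m, q)%:R :> K.
Proof.
move=> /pcharf0P HK; rewrite /binz.
have -> : \prod_(j < q) ((m%:Z - (j : nat)%:Z)%:~R : K) = (m ^_ q)%:R.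
  elim: q => [|q IH]; first by rewrite big_ord0 ffactn0.
  rewrite big_ord_recr /= IH ffactnSr natrM.
  case: (leqP q m) => hq; first by rewrite rmorphB /= natrB.
  by rewrite ffact_small // !mul0r.
by rewrite -bin_ffact natrM mulfK // HK -lt0n fact_gt0.
Qed.

(** Each term of the derivation [L(-1)] on a monomial raises one index in place; this form shows, up
    to order, which index is replaced. *)
Lemma perm_incr_nth (s : seq nat) i : (i < size s)%N ->
  perm_eq (incr_nth s i) ((nth 0%N s i).+1 :: rem (nth 0%N s i) s).
Proof.
elim: s i => [|x s IH] [|i] //= hi; first by rewrite eqxx.
have := IH i hi; rewrite -(perm_cons x) => /perm_trans -> //.
apply: (@perm_trans _ ((nth 0%N s i).+1 :: x :: rem (nth 0%N s i) s)).
  by rewrite (perm_catCA [:: x] [:: _]).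
rewrite perm_cons; case: eqP => [->|_] //.
by rewrite perm_sym; apply: perm_to_rem; apply: mem_nth.
Qed.

(** Index list of the ordered monomial [om u J e]; it translates exponent notation into the list
    notation of [umon]. *)
Fixpoint expseq (J : nat) (e : nat -> nat) : seq nat :=
  if J is J'.+1 then nseq (e J'.+1) J'.+1 ++ expseq J' e else [::].

Lemma count_expseq J e x :
  count_mem x (expseq J e) = if (0 < x <= J)%N then e x else 0%N.
Proof.
elim: J => [|J IH] /=; first by case: x.
rewrite count_cat IH count_nseq /=.
case: (altP (J.+1 =P x)) => [<-|h]; first by rewrite leqnn ltnn andbF addn0 mul1n.
by rewrite mul0n add0n [(x <= J.+1)%N]leq_eqVlt eq_sym (negbTE h).
Qed.

Lemma all_expseq J e : all (fun k => 0 < k)%N (expseq J e).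
Proof.
elim: J => //= J IH; rewrite all_cat IH andbT.
by apply/allP => x; rewrite mem_nseq => /andP[_ /eqP->].
Qed.

Lemma sum_expseq (M : nmodType) J e (G : nat -> M) :
  \sum_(x <- expseq J e) G x = \sum_(1 <= l < J.+1) G l *+ e l.
Proof.
elim: J => [|J IH]; first by rewrite big_nil big_geq.
by rewrite /= big_cat /= IH big_nseq -Monoid.iteropE [RHS]big_nat_recr //= addrC.
Qed.

Lemma size_expseq J e : size (expseq J e) = (\sum_(1 <= l < J.+1) e l)%N.
Proof.
elim: J => [|J IH]; first by rewrite big_geq.
by rewrite /= size_cat size_nseq IH [RHS]big_nat_recr //= addnC.
Qed.

Lemma perm_count (s t : seq nat) :
  (forall x, count_mem x s = count_mem x t) -> perm_eq s t.
Proof. by move=> h; apply/allP => x _ /=; rewrite h. Qed.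

Lemma perm_expseq_count J ks :
  all (fun k => 0 < k <= J)%N ks -> perm_eq ks (expseq J (fun j => count_mem j ks)).
Proof.
move=> /allP h; apply: perm_count => x; rewrite count_expseq.
by case: ifP => // hx; apply/count_memPn/negP => /h; rewrite hx.
Qed.

(** Passage from the exponents of $M$ to those of $M^{(l)}$. The truncation at [e l = 0] is
    harmless, since such a term always carries the factor [e l]. *)
Definition raise (l : nat) (e : nat -> nat) (j : nat) : nat :=
  if j == l.+1 then (e j).+1 else if j == l then (e j).-1 else e j.

(** [expseq J e] does not see [e J.+1], while the left side does; hence the vanishing condition. *)
Lemma perm_expseq_raise J e l : e J.+1 = 0%N -> l \in expseq J e ->
  perm_eq (expseq J.+1 (raise l e)) (l.+1 :: rem l (expseq J e)).
Proof.
move=> eJ le; apply: perm_count => x.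
have hl := le; rewrite -has_pred1 has_count count_expseq in hl.
move: hl; case: ifP => // /andP[l0 lJ] el.
rewrite count_expseq /= count_rem le count_expseq /raise.
case: (altP (x =P l.+1)) => [->|h1].
  rewrite eqxx /= ltnS lJ; case: (ltngtP l J) => h //; try lia.
  by rewrite h eJ; lia.
rewrite [l.+1 == x]eq_sym (negbTE h1) add0n -[X in (_ - X)%N]/(l == x : nat) [l == x]eq_sym.
case: (altP (x =P l)) => [->|_]; first by rewrite l0 lJ leqW // subn1.
rewrite subn0 [(x <= J.+1)%N]leq_eqVlt ltnS.
by case: (altP (x =P J.+1)) => [->|_]; rewrite ?ltnn ?eJ //= if_same.
Qed.

End Preliminaries.

(** * Linear spans *)

Section Span.
Set Implicit Arguments.
Unset Strict Implicit.
Variables (K : fieldType) (V : lmodType K).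
Implicit Types (P Q : V -> Prop) (x y : V).

Lemma inspan_ind P Q x : inspan P x -> Q 0 ->
  (forall c y z, P y -> Q z -> Q (c *: y + z)) -> Q x.
Proof.
case=> s [sP ->] Q0 QL; elim: sP => [|p s' pP _ IH]; first by rewrite big_nil.
by rewrite big_cons; apply: QL.
Qed.

Lemma inspan0 P : inspan P 0.
Proof. by exists [::]; rewrite big_nil. Qed.

Lemma inspan_lin P c x y : inspan P x -> inspan P y -> inspan P (c *: x + y).
Proof.
move=> hx hy; apply: (inspan_ind (Q := fun x => inspan P (c *: x + y)) hx).
  by rewrite scaler0 add0r.
move=> d z t hz [s [sP sE]]; exists ((c * d, z) :: s); split; first by constructor.
by rewrite big_cons -sE scalerDr scalerA addrA.
Qed.

Lemma inspan_gen P x : P x -> inspan P x.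
Proof. by move=> hx; exists [:: (1, x)]; rewrite big_seq1 scale1r; split => //; constructor. Qed.

Lemma inspanS P Q x : (forall y, P y -> Q y) -> inspan P x -> inspan Q x.
Proof.
move=> PQ hx; apply: (inspan_ind hx) (inspan0 Q) _ => c y z hy.
by apply: inspan_lin; apply/inspan_gen/PQ.
Qed.

Lemma inspan_map P Q (f : V -> V) x :
  (forall c y z, f (c *: y + z) = c *: f y + f z) ->
  (forall y, P y -> Q (f y)) -> inspan P x -> inspan Q (f x).
Proof.
move=> fL PQ hx; apply: (inspan_ind (Q := fun x => inspan Q (f x)) hx).
  have := fL (-1) 0 0; rewrite scaler0 addr0 scaleN1r addNr => ->; exact: inspan0.
by move=> c y z hy; rewrite fL; apply: inspan_lin; apply/inspan_gen/PQ.
Qed.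

Lemma lin_sum (Q : V -> Prop) (I : Type) (r : seq I) (B : pred I) (c : I -> K) (F : I -> V) :
  Q 0 -> (forall d y z, Q y -> Q z -> Q (d *: y + z)) ->
  (forall i, B i -> Q (F i)) -> Q (\sum_(i <- r | B i) c i *: F i).
Proof.
move=> Q0 QL QF; elim: r => [|i r IH]; first by rewrite big_nil.
by rewrite big_cons; case: ifP => // /QF hi; apply: QL.
Qed.

End Span.

(** * Commutators of modes, translation, weights, and elements of $O_n(V)$ *)

Section Modes.
Set Implicit Arguments.
Unset Strict Implicit.
Variables (K : fieldType) (HK : [pchar K] =i pred0).
Variables (V : lmodType K) (Y : V -> int -> V -> V) (vac omega : V) (cc : K).
Hypothesis HV : isVOA Y vac omega cc.
Implicit Types (a b c x v w : V) (j k m : int).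

Lemma modeD a k x y : Y a k (x + y) = Y a k x + Y a k y.
Proof. by have := Y_linr HV a x y k 1; rewrite !scale1r. Qed.

Lemma mode0 a k : Y a k 0 = 0.
Proof. by have := Y_linr HV a 0 0 k (-1); rewrite scaler0 addr0 scaleN1r addNr. Qed.

Lemma modeZ a k d x : Y a k (d *: x) = d *: Y a k x.
Proof. by have := Y_linr HV a x 0 k d; rewrite mode0 !addr0. Qed.

Lemma modeB a k x y : Y a k (x - y) = Y a k x - Y a k y.
Proof. by rewrite -scaleN1r modeD modeZ scaleN1r. Qed.

Lemma mode_sum a k I (r : seq I) (B : pred I) (F : I -> V) :
  Y a k (\sum_(i <- r | B i) F i) = \sum_(i <- r | B i) Y a k (F i).
Proof. exact: (big_morph (Y a k) (modeD a k) (mode0 a k)). Qed.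

Lemma modeZl a k d x : Y (d *: a) k x = d *: Y a k x.
Proof.
have h0 : Y 0 k x = 0.
  by have := Y_linl HV 0 0 x k (-1); rewrite scaler0 addr0 scaleN1r addNr.
by have := Y_linl HV a 0 x k d; rewrite h0 !addr0.
Qed.

Lemma binz0 (p : int) : binz p 0 = 1 :> K.
Proof. by rewrite /binz big_ord0 fact0 divr1. Qed.

(** The Borcherds identity at $l=0$: the factor $\binom{0}{i}$ leaves only $i=0$ on the right, and
    the bound [N.+1] ensures that this term is in the range. *)
Lemma commutator a b x (m n : int) : exists N, forall N', (N <= N')%N ->
  \sum_(i < N') binz m i *: Y (Y a (i : nat)%:Z b) (m + n - (i : nat)%:Z) x
    = Y a m (Y b n x) - Y b n (Y a m x).
Proof.
have [N HN] := borcherds HV a b x 0 m n; exists N.+1 => N' hN.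
have := HN N' (ltnW hN); case: N' hN => // N' _.
under eq_bigr do rewrite add0r.
move=> ->; rewrite big_ord_recl big1 => [|i _].
  by rewrite addr0 /= !add0r expr0 binz0 mul1r !scale1r !subr0.
by rewrite (binz_nat 0 _ HK) bin_small // mulr0 scale0r.
Qed.

Lemma modes_commute a b x (m n : int) :
  (forall j, 0 <= j -> Y a j b = 0) -> Y a m (Y b n x) = Y b n (Y a m x).
Proof.
move=> ab0; have [N /(_ N (leqnn N))] := commutator a b x m n.
rewrite big1 => [/esym/eqP|i _]; first by rewrite subr_eq0 => /eqP.
rewrite ab0 //.
have := Y_linl HV 0 0 x (m + n - (i : nat)%:Z) (-1).
by rewrite scaler0 addr0 scaleN1r addNr => ->; rewrite scaler0.
Qed.

Lemma Lop_lin m d x y :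
  Lop Y omega m (d *: x + y) = d *: Lop Y omega m x + Lop Y omega m y.
Proof. exact: Y_linr HV _ _ _ _ _. Qed.

(** $L(-1)=\omega_0$, so the commutator formula reduces to $[L(-1),a_k]=(L(-1)a)_k=-k\,a_{k-1}$. *)
Lemma translation_mode a k x :
  Lop Y omega (-1) (Y a k x)
    = Y a k (Lop Y omega (-1) x) + (- k)%:~R *: Y a (k - 1) x.
Proof.
have [N /(_ N.+1 (leqnSn N))] := commutator omega a x 0 k.
rewrite big_ord_recl big1 => [|i _].
  rewrite addr0 subr0 add0r binz0 scale1r => h.
  have := L_deriv HV a k x; rewrite /Lop addNr h => <-.
  by rewrite addrC subrK.
by rewrite (binz_nat 0 _ HK) bin_small // scale0r.
Qed.

(** $L(0)=\omega_1$ leaves two commutator terms, $(L(-1)a)_{k+1}=-(k+1)a_k$ and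
    $(L(0)a)_k=\mathrm{wt}(a)\,a_k$. *)
Lemma weight_mode a wa k x : homog Y omega a wa ->
  Lop Y omega 0 (Y a k x)
    = Y a k (Lop Y omega 0 x) + (wa - k - 1)%:~R *: Y a k x.
Proof.
move=> ha; have [N /(_ N.+2 (leqW (leqnSn N)))] := commutator omega a x 1 k.
rewrite !big_ord_recl big1 => [|i _]; last first.
  by rewrite (binz_nat 1 _ HK) bin_small ?scale0r.
rewrite !(binz_nat 1 _ HK) /= !scale1r subr0 addr0 [1 + k - _]addrAC subrr add0r => h.
have := L_deriv HV a (1 + k) x; rewrite /Lop addNr [1 + k - 1]addrAC subrr add0r => h1.
move: ha; rewrite /homog /Lop add0r => ha.
rewrite h1 (ha : Y omega (bump 0 0) a = _) modeZl -scalerDl in h.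
rewrite -[Y omega 1 _](subrK (Y a k (Y omega 1 x))) -h addrC; congr (_ + _ *: _).
by rewrite -rmorphD /=; congr (_%:~R); lia.
Qed.

Lemma homog_mode a wa k b wb : homog Y omega a wa -> homog Y omega b wb ->
  homog Y omega (Y a k b) (wa + wb - k - 1).
Proof.
move=> ha hb; rewrite /homog (weight_mode _ _ ha) hb modeZ -scalerDl -rmorphD /=.
by congr (_%:~R *: _); lia.
Qed.

Lemma Lop_vac m : -1 <= m -> Lop Y omega m vac = 0.
Proof. by move=> hm; apply: (creation0 HV); lia. Qed.

Lemma homog_iter_translation a wa (m : nat) : homog Y omega a wa ->
  homog Y omega (iter m (Lop Y omega (-1)) a) (wa + m%:Z).
Proof.
move=> ha; elim: m => [|m IH]; first by rewrite addr0.
have := homog_mode (-1 + 1) (omega_wt HV) IH; rewrite iterS /homog => ->.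
by congr (_%:~R *: _); lia.
Qed.

(** Iterating $(L(-1)a)_j=-j\,a_{j-1}$ gives $d=(-j)(-j+1)\cdots(-j+m-1)$, a product of positive
    integers when $j<0$, hence nonzero in characteristic zero. *)
Lemma iter_translation_mode a (m : nat) j : exists d : K,
  (j < 0 -> d != 0) /\
  forall x, Y (iter m (Lop Y omega (-1)) a) j x = d *: Y a (j - m%:Z) x.
Proof.
elim: m j => [|m IH] j.
  by exists 1; rewrite oner_eq0; split => // x; rewrite scale1r subr0.
have [d [d0 dE]] := IH (j - 1); exists ((- j)%:~R * d); split => [hj|x].
  rewrite mulf_neq0 ?d0 //; last by lia.
  have -> : - j = (`|j|.-1).+1%:Z by lia.
  by move/pcharf0P: HK => ->.
rewrite iterS (L_deriv HV) dE scalerA; congr (_ *: Y _ _ _); lia.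
Qed.

Lemma OL_translate x : OL Y omega (Lop Y omega (-1) x + Lop Y omega 0 x).
Proof. by exists x. Qed.

Lemma isRes_bounded (f : nat -> V) N :
  (forall i, (N <= i)%N -> f i = 0) -> isRes f (\sum_(i < N) f i).
Proof.
move=> fN; exists N => N' hN; rewrite -!(big_mkord xpredT f).
rewrite (big_cat_nat _ (n := N)) //= -[RHS]addr0; congr (_ + _).
by rewrite big_nat big1 // => i /andP[/fN].
Qed.

Variable n : nat.

Lemma On_lin d x y : On Y omega n x -> On Y omega n y -> On Y omega n (d *: x + y).
Proof.
move=> [x1 [x2 [[p ->] [h2 ->]]]] [y1 [y2 [[q ->] [k2 ->]]]].
exists (Lop Y omega (-1) (d *: p + q) + Lop Y omega 0 (d *: p + q)), (d *: x2 + y2).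
split; first exact: OL_translate.
split; first exact: inspan_lin.
rewrite !Lop_lin !scalerDr -!addrA; congr (_ + _).
rewrite [RHS]addrCA; congr (_ + _); rewrite [LHS]addrCA; congr (_ + _).
exact: addrCA.
Qed.

Lemma On_OL x : OL Y omega x -> On Y omega n x.
Proof. by move=> h; exists x, 0; split=> //; split; [exact: inspan0 | rewrite addr0]. Qed.

Lemma On_Ocirc x : Ocirc Y omega n x -> On Y omega n x.
Proof.
move=> h; exists 0, x; split; last by rewrite add0r.
by exists 0; rewrite /Lop !mode0 addr0.
Qed.

Lemma On0 : On Y omega n 0.
Proof. by apply: On_OL; exists 0; rewrite /Lop !mode0 addr0. Qed.

(** When $\mathrm{wt}\,a+n\ge 0$ the series $(1+x)^{\mathrm{wt}\,a+n}$ is a polynomial, so the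
    residue has an explicit range. This is where $\mathrm{wt}\,u\ge -n$ enters. *)
Lemma Ocirc_nonneg_weight a wa q x : homog Y omega a wa -> wa + n%:Z = q%:Z ->
  Ocirc Y omega n
    (\sum_(i < q.+1) 'C(q, i)%:R *: Y a ((i : nat)%:Z - (2 * n)%:Z - 2) x).
Proof.
move=> ha hq; apply: inspan_gen; exists a, wa, x; split=> //.
under eq_bigr do rewrite -(binz_nat _ _ HK) -hq.
apply: (isRes_bounded (f := fun i => binz (wa + n%:Z) i *: _)) => i hi.
by rewrite hq (binz_nat _ _ HK) bin_small // scale0r.
Qed.

End Modes.

(** * Reordering and translating monomials in the modes of $u$ *)

Section Monomials.
Set Implicit Arguments.
Unset Strict Implicit.
Variables (K : fieldType) (HK : [pchar K] =i pred0).
Variables (V : lmodType K) (Y : V -> int -> V -> V) (vac omega : V) (cc : K).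
Hypothesis HV : isVOA Y vac omega cc.
Variables (u : V) (wu : int).
Hypothesis Hu : homog Y omega u wu.

(** The two consequences of the permutation property used later: sorting costs only shorter
    monomials, and a nonnegative mode of $u$ does not increase the length. *)
Definition permutable (w : V) : Prop :=
  (forall ks ks', perm_eq ks ks' ->
     Fr Y u (size ks).-1 w (umon Y u ks w - umon Y u ks' w)) /\
  (forall j ks, 0 <= j -> Fr Y u (size ks) w (Y u j (umon Y u ks w))).

Lemma umon_gmon ks w : umon Y u ks w = gmon Y [seq (u, k%:Z) | k : nat <- ks] w.
Proof. by rewrite /umon /gmon foldr_map. Qed.

Lemma umonZ ks d x : umon Y u ks (d *: x) = d *: umon Y u ks x.
Proof. by elim: ks => //= k ks ->; rewrite (modeZ HV). Qed.

Lemma umon_mode_commute v k ks x : (forall j, 0 <= j -> Y u j v = 0) ->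
  umon Y u ks (Y v k x) = Y v k (umon Y u ks x).
Proof. by move=> uv; elim: ks => //= m ks ->; rewrite (modes_commute HK HV). Qed.

Lemma Fr0 r w : Fr Y u r w 0.
Proof. exact: inspan0. Qed.

Lemma Vgen_umon ks : all (fun k => 0 < k)%N ks -> Vgen Y vac u (umon Y u ks vac).
Proof. by move=> h; apply: inspan_gen; exists ks. Qed.

Lemma Vgen_self : Vgen Y vac u u.
Proof. by rewrite -{2}(creation1 HV u); apply: (@Vgen_umon [:: 1%N] isT). Qed.

Lemma Vgen_modes (ks : seq int) :
  List.Forall (fun p : V * int => Vgen Y vac u p.1) [seq (u, k) | k <- ks].
Proof. by elim: ks => //= k ks IH; constructor => //=; apply: Vgen_self. Qed.

(* The modes of [v] commute with those of [u], which moves the permutation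
   property from the vacuum to [v_k vac]. *)
Lemma permutable_mode v k : perm_prop Y vac u (Vgen Y vac u) ->
  (forall j, 0 <= j -> Y u j v = 0) -> permutable (Y v k vac).
Proof.
move=> Hp uv.
have FrY r x : Fr Y u r vac x -> Fr Y u r (Y v k vac) (Y v k x).
  apply: inspan_map => [c y z|y [ks [h1 [h2 ->]]]]; first exact: (Y_linr HV).
  by exists ks; rewrite umon_mode_commute.
have Vvac : Vgen Y vac u vac by apply: (@Vgen_umon [::]).
split=> [ks ks' h|j ks j0].
  rewrite !umon_mode_commute // -(modeB HV).
  case: (posnP (size ks)) => [/size0nil E|ks0].
    have := perm_size h; rewrite E => /esym/size0nil ->.
    by rewrite subrr (mode0 HV); apply: Fr0.
  rewrite !umon_gmon; apply: FrY.
  have -> : size ks = size [seq (u, m%:Z) | m : nat <- ks] by rewrite size_map.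
  apply: Hp => //; rewrite ?size_map ?perm_map //.
  have -> : [seq (u, m%:Z) | m : nat <- ks] = [seq (u, k0) | k0 <- map Posz ks].
    by rewrite -map_comp.
  exact: Vgen_modes.
rewrite umon_mode_commute // (modes_commute HK HV) //; apply: FrY.
(* Moved to the right end, $u_j$ annihilates the vacuum, so the permutation property bounds the
   whole monomial and not just a difference. *)
pose t := rcons [seq (u, m%:Z) | m : nat <- ks] (u, - j).
have := Hp ((u, - j) :: [seq (u, m%:Z) | m : nat <- ks]) t vac isT.
rewrite {2}/t /gmon /= foldr_rcons /= opprK (creation0 HV) // size_map.
have -> : foldr (fun p : V * int => [eta Y p.1 (- p.2)]) 0 [seq (u, m%:Z) | m : nat <- ks] = 0.
  by elim: (ks) => //= m s ->; rewrite (mode0 HV).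
rewrite subr0 -/(gmon Y _ vac) -umon_gmon; apply => //.
  by rewrite perm_sym perm_rcons.
have -> : [seq (u, m%:Z) | m : nat <- ks] = [seq (u, k0) | k0 <- map Posz ks].
  by rewrite -map_comp.
exact: (@Vgen_modes (- j :: map Posz ks)).
Qed.

Lemma translation_umon ks w :
  Lop Y omega (-1) (umon Y u ks w) = umon Y u ks (Lop Y omega (-1) w)
    + \sum_(i < size ks) (nth 0%N ks i)%:R *: umon Y u (incr_nth ks i) w.
Proof.
elim: ks => [|k ks IH]; first by rewrite big_ord0 addr0.
rewrite /= (translation_mode HK HV) IH (modeD HV) (mode_sum HV) big_ord_recl /=.
rewrite -addrA; congr (_ + _); rewrite addrC opprK; congr (_ + _).
  by congr (_ *: Y _ _ _); lia.
by apply: eq_bigr => i _; rewrite (modeZ HV).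
Qed.

Lemma homog_umon ks w ww : homog Y omega w ww ->
  homog Y omega (umon Y u ks w) (ww + \sum_(k <- ks) (wu + k%:Z - 1)).
Proof.
move=> hw; elim: ks => [|k ks IH]; first by rewrite big_nil addr0.
rewrite big_cons /= /homog (homog_mode HK HV (- k%:Z) Hu IH).
by congr (_%:~R *: _); ring.
Qed.

Lemma translate_creation v k :
  Lop Y omega (-1) (Y v (- k%:Z) vac) = k%:R *: Y v (- k%:Z - 1) vac.
Proof. by rewrite (translation_mode HK HV) (Lop_vac HV) // (mode0 HV) add0r opprK. Qed.

Lemma homog_creation v wv k : homog Y omega v wv ->
  homog Y omega (Y v (- k%:Z) vac) (wv + k%:Z - 1).
Proof.
move=> hv; have h0 : homog Y omega vac 0 by rewrite /homog (Lop_vac HV) // scale0r.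
have := homog_mode HK HV (- k%:Z) hv h0; rewrite /homog => ->.
by congr (_%:~R *: _); lia.
Qed.

Lemma om_umon J e w : om Y u J e w = umon Y u (expseq J e) w.
Proof.
elim: J => //= J ->; rewrite /umon foldr_cat.
by elim: (e J.+1) => //= m ->.
Qed.

Lemma eq_om J e e' w : (forall j, (0 < j <= J)%N -> e j = e' j) ->
  om Y u J e w = om Y u J e' w.
Proof.
elim: J => //= J IH h; rewrite h ?leqnn // IH // => j /andP[j0 jJ].
by apply: h; rewrite j0 ltnW.
Qed.

(** Serves the commuting case, in which the sorting error $f$ must vanish exactly. *)
Lemma umon_perm ks ks' w :
  (forall j j' x, (0 < j)%N -> (0 < j')%N ->
     Y u (- j%:Z) (Y u (- j'%:Z) x) = Y u (- j'%:Z) (Y u (- j%:Z) x)) ->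
  all (fun k => 0 < k)%N ks -> perm_eq ks ks' -> umon Y u ks w = umon Y u ks' w.
Proof.
move=> hc; elim: ks ks' => [|k ks IH] ks' /=.
  by rewrite perm_sym => _ /perm_nilP ->.
move=> /andP[k0 hks] hp.
have hk : k \in ks' by rewrite -(perm_mem hp) mem_head.
case/splitPr: ks' / hk hp => a b hp.
have hab : perm_eq ks (a ++ b).
  by rewrite -(perm_cons k) (permPl hp) -(cat1s k b) perm_catCA.
have : all (fun k => 0 < k)%N a.
  by move: hks; rewrite (perm_all _ hab) all_cat => /andP[].
rewrite (IH _ hks hab); elim: a {hp hab} => //= l a IHa /andP[l0 ha].
by rewrite -IHa // hc.
Qed.

(** The derivation leaves raised monomials unsorted; $f$ is the total cost of sorting them, so it is
    of smaller length and vanishes when the modes commute. *)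
Lemma translation_om J e w : e J.+1 = 0%N -> permutable w -> exists f,
  Fr Y u (\sum_(1 <= l < J.+1) e l)%N.-1 w f /\
  ((forall j j' x, (0 < j)%N -> (0 < j')%N ->
     Y u (- j%:Z) (Y u (- j'%:Z) x) = Y u (- j'%:Z) (Y u (- j%:Z) x)) -> f = 0) /\
  Lop Y omega (-1) (om Y u J e w) = om Y u J e (Lop Y omega (-1) w)
    + \sum_(1 <= l < J.+1) (l * e l)%:R *: om Y u J.+1 (raise l e) w + f.
Proof.
move=> eJ [gp _]; set s := expseq J e.
have hperm i : (i < size s)%N ->
    perm_eq (incr_nth s i) (expseq J.+1 (raise (nth 0%N s i) e)).
  move=> hi; rewrite (perm_trans (perm_incr_nth hi)) // perm_sym.
  by apply: perm_expseq_raise; rewrite // mem_nth.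
have sE i : (i < size s)%N -> size (incr_nth s i) = size s.
  by move=> hi; rewrite size_incr_nth hi.
exists (\sum_(i < size s) (nth 0%N s i)%:R *:
   (umon Y u (incr_nth s i) w - om Y u J.+1 (raise (nth 0%N s i) e) w)).
split; [|split].
- rewrite -size_expseq; apply: lin_sum => [||i _]; first exact: Fr0.
    by move=> d y z; apply: inspan_lin.
  by have := gp _ _ (hperm i (ltn_ord i)); rewrite om_umon sE.
- move=> hc; apply: big1 => i _; rewrite om_umon -(umon_perm w hc _ (hperm i _)) //.
    by rewrite subrr scaler0.
  by rewrite (perm_all _ (hperm i _)) // all_expseq.
- rewrite !om_umon translation_umon -addrA; congr (_ + _).
  (* Grouping list positions by their value: the index $l$ occurs [e l] times, each time with
     coefficient $l$. *)
  have -> : \sum_(1 <= l < J.+1) (l * e l)%:R *: om Y u J.+1 (raise l e) w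
     = \sum_(i < size s) (nth 0%N s i)%:R *: om Y u J.+1 (raise (nth 0%N s i) e) w.
    pose G (l : nat) := l%:R *: om Y u J.+1 (raise l e) w.
    rewrite -(big_mkord xpredT (fun i => G (nth 0%N s i))) -(big_nth 0%N xpredT G).
    rewrite sum_expseq; apply: eq_bigr => l _.
    by rewrite natrM mulr_natr -scalerMnl.
  by rewrite -big_split /=; apply: eq_bigr => i _; rewrite scalerBr [RHS]addrC subrK.
Qed.

End Monomials.

(** * Part (2), and reduction of monomials to indices at most $2n$ *)

Section Reduction.
Set Implicit Arguments.
Unset Strict Implicit.
Variables (K : fieldType) (HK : [pchar K] =i pred0).
Variables (V : lmodType K) (Y : V -> int -> V -> V) (vac omega : V) (cc : K).
Hypothesis HV : isVOA Y vac omega cc.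
Variables (n : nat) (u : V) (wu : int).
Hypothesis Hu : homog Y omega u wu.

Lemma OL_translate_sub d v wv k m : m != 0%N -> homog Y omega v wv ->
  d = wu + wv + m%:Z + k%:Z - 2 ->
  OL Y omega
    (Y u (- (m + 1)%:Z) (Y v (- k%:Z) vac)
     - (- (d%:~R / m%:R) *: Y u (- m%:Z) (Y v (- k%:Z) vac)
        - (k%:R / m%:R) *: Y u (- m%:Z) (Y v (- k%:Z - 1) vac))).
Proof.
move=> m0 hv dE.
have m0' : m%:R != 0 :> K by move/pcharf0P: HK => ->.
set w := Y v (- k%:Z) vac.
(* $L(-1)$ raises $u_{-m}$ to $m\,u_{-m-1}$ and $v_{-k}\mathbf 1$ to $k\,v_{-k-1}\mathbf 1$, while
   $L(0)$ contributes the weight [d]. *)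
exists (m%:R^-1 *: Y u (- m%:Z) w).
have hw := homog_creation HK HV k hv.
have -> x : Lop Y omega (-1) (m%:R^-1 *: x) = m%:R^-1 *: Lop Y omega (-1) x.
  exact: (modeZ HV).
have -> x : Lop Y omega 0 (m%:R^-1 *: x) = m%:R^-1 *: Lop Y omega 0 x.
  exact: (modeZ HV).
rewrite (translation_mode HK HV) (translate_creation HK HV) (modeZ HV).
rewrite (homog_mode HK HV (- m%:Z) Hu hw) opprK scalerDr !scalerA -pmulrn mulVf // scale1r.
rewrite scaleNr -opprD opprK [RHS](AC (2*1) (2*(3*1))) /=.
congr (_ + (_ + _)); first by congr (Y _ _ _); lia.
  by rewrite dE mulrC; congr (_ * _%:~R *: _); lia.
by rewrite mulrC.
Qed.

Hypothesis Hwu : - n%:Z <= wu.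

(** This is $u\circ_n x$: its term $i=0$ is $u_{-2n-2}x$, and the others form $Dx$. Thus
    $u_{-2n-2}x\equiv_n -Dx$. *)
Lemma Ocirc_top x :
  Ocirc Y omega n (Y u (- (2 * n).+2%:Z) x
    + \sum_(1 <= j < (absz (n%:Z + wu)).+1)
        ('C(absz (n%:Z + wu), j.-1))%:R *: Y u (wu - n%:Z - j%:Z - 1) x).
Proof.
set q := absz _; have qE : wu + n%:Z = q%:Z by rewrite /q; lia.
apply: (eq_ind _ (Ocirc Y omega n) (Ocirc_nonneg_weight HK x Hu qE)).
rewrite big_ord_recl bin0 scale1r; congr (_ + _).
  by congr (Y _ _ _) => /=; lia.
(* The residue is indexed from the lowest mode and $D$ from the highest; the reversal is absorbed by
   the symmetry of binomials. *)
rewrite big_add1 /= big_mkord [RHS](reindex_inj rev_ord_inj) /=.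
apply: eq_bigr => i _; have hi := ltn_ord i; congr (_%:R *: Y _ _ _).
  by rewrite bin_sub.
by rewrite /bump; lia.
Qed.

Hypothesis Hn : (0 < n)%N.
Hypothesis Hperm : perm_prop Y vac u (Vgen Y vac u).
Variable W : V -> Prop.
Hypothesis HW : forall v, W v ->
  (exists wv, homog Y omega v wv) /\ (forall j, 0 <= j -> Y u j v = 0).

Definition low_span : V -> Prop :=
  inspan (fun y => exists e v' (k : nat), W v' /\ (0 < k)%N /\
            y = om Y u (2 * n) e (Y v' (- k%:Z) vac)).

Definition reducible (x : V) : Prop :=
  exists z, low_span z /\ On Y omega n (x - z).

Lemma reducible_lin d x y : reducible x -> reducible y -> reducible (d *: x + y).
Proof.
move=> [z [hz hx]] [t [ht hy]]; exists (d *: z + t); split; first exact: inspan_lin.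
by rewrite opprD addrACA -scalerBr; apply: (On_lin HV).
Qed.

Lemma reducible_On x : On Y omega n x -> reducible x.
Proof. by move=> hx; exists 0; rewrite subr0; split=> //; apply: inspan0. Qed.

Lemma reducible0 : reducible 0.
Proof. exact/reducible_On/(On0 HV). Qed.

Lemma reducibleZ d x : reducible x -> reducible (d *: x).
Proof. by move=> hx; rewrite -[_ *: _]addr0; apply: reducible_lin hx reducible0. Qed.

Lemma reducibleD x y : reducible x -> reducible y -> reducible (x + y).
Proof. by move=> hx hy; rewrite -[x]scale1r; apply: reducible_lin. Qed.

Lemma reducibleB x y : reducible x -> reducible y -> reducible (x - y).
Proof. by move=> hx hy; rewrite -scaleN1r addrC; apply: reducible_lin. Qed.

Lemma reducible_sum N (c : 'I_N -> K) (F : 'I_N -> V) :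
  (forall i, reducible (F i)) -> reducible (\sum_(i < N) c i *: F i).
Proof. by move=> h; apply: lin_sum => //; [exact: reducible0 | exact: reducible_lin]. Qed.

Lemma reducible_cancel d x y : d != 0 ->
  reducible (y - d *: x) -> reducible y -> reducible x.
Proof.
move=> d0 h hy; have := reducibleZ d^-1 (reducibleB hy h).
by rewrite opprB addrC subrK scalerA mulVf // scale1r.
Qed.

(** Quantified over [v] and [k] because $L(-1)$ also changes $v_{-k}\mathbf 1$ into $v_{-k-1}\mathbf
    1$. *)
Definition monomials_reduce (ks : seq nat) : Prop :=
  all (fun k => 0 < k)%N ks -> forall v k, W v -> (0 < k)%N ->
  reducible (umon Y u ks (Y v (- k%:Z) vac)).

Definition lower_degree_reduces (r : nat) : Prop :=
  forall ks, (size ks < r)%N -> monomials_reduce ks.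

Lemma permutable_W v k : W v -> permutable Y u (Y v k vac).
Proof. by case/HW => _ hv; apply: (permutable_mode HK HV). Qed.

Lemma reducible_Fr r r' v k x : lower_degree_reduces r -> (r' < r)%N ->
  W v -> (0 < k)%N -> Fr Y u r' (Y v (- k%:Z) vac) x -> reducible x.
Proof.
move=> hr lt hv k0 hx; apply: (inspan_ind hx reducible0) => c y z [ks [h1 [h2 ->]]].
by apply: reducible_lin; apply: hr => //; apply: leq_ltn_trans h1 lt.
Qed.

(** Once shorter monomials reduce, the order of the factors is immaterial. *)
Lemma monomials_reduce_perm ks ks' : lower_degree_reduces (size ks) ->
  perm_eq ks ks' -> monomials_reduce ks' -> monomials_reduce ks.
Proof.
move=> hr hp; case: (posnP (size ks)) => [/size0nil E|ks0].
  by move: hp; rewrite E perm_sym => /perm_nilP ->.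
move=> h hk v k hv k0; rewrite -[umon _ _ _ _](subrK (umon Y u ks' (Y v (- k%:Z) vac))).
apply: reducibleD; last by apply: h; rewrite // -(perm_all _ hp).
apply: (reducible_Fr hr _ hv k0 ((permutable_W _ hv).1 _ _ hp)).
by rewrite prednK.
Qed.

(* [u_{-m}] with [m = 2n+2+t] is, up to a nonzero factor, the leading term of
   [(L(-1)^t u) o_n b]. *)
Lemma reduce_large m s : lower_degree_reduces (size s).+1 ->
  (forall l, size l = (size s).+1 -> (sumn l < m + sumn s)%N -> monomials_reduce l) ->
  (2 * n + 2 <= m)%N -> monomials_reduce (m :: s).
Proof.
move=> hr hs hm s1 v k hv k0; have s0 : all (fun k => 0 < k)%N s by case/andP: s1.
rewrite -[umon _ _ _ _]/(Y u (- m%:Z) (umon Y u s (Y v (- k%:Z) vac))).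
set b := umon Y u s _.
(* Chosen so that $(L(-1)^t u)_{-2n-2}$ is a nonzero multiple of $u_{-2n-2-t}=u_{-m}$. *)
pose t := (m - (2 * n + 2))%N.
pose q := absz (wu + t%:Z + n%:Z).
have qE : wu + t%:Z + n%:Z = q%:Z by rewrite /q; lia.
have := Ocirc_nonneg_weight HK b (homog_iter_translation HK HV t Hu) qE.
move/(On_Ocirc HV)/reducible_On; rewrite big_ord_recl bin0 scale1r.
have [d [d0 ->]] := iter_translation_mode HK HV u t (0 - (2 * n)%:Z - 2).
have -> : 0 - (2 * n)%:Z - 2 - t%:Z = - m%:Z by rewrite /t; lia.
move=> h; have {d0} d0 : d != 0 by apply: d0; lia.
rewrite -[Y u _ b]scale1r -(mulVf d0) -scalerA; apply: reducibleZ.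
rewrite -[_ *: _](addrK (\sum_(i < q) 'C(q, lift ord0 i)%:R *:
  Y (iter t (Lop Y omega (-1)) u) ((lift ord0 i)%:Z - (2 * n)%:Z - 2) b)).
apply: reducibleB; first exact: h.
apply: reducible_sum => i /=.
have [c [_ ->]] := iter_translation_mode HK HV u t ((bump 0 i)%:Z - (2 * n)%:Z - 2).
apply: reducibleZ; set j := _ - t%:Z.
(* A remaining mode is either nonnegative, which leaves only shorter monomials, or has index smaller
   than $m$, which lowers the index sum. *)
case: (lerP 0 j) => hj.
  by apply: (reducible_Fr hr _ hv k0 ((permutable_W _ hv).2 _ _ hj)).
have -> : j = - `|j|%N%:Z by lia.
apply: (hs (`|j|%N :: s)) => //=; last by rewrite s0 andbT; lia.
have tm : (t + (2 * n + 2))%N = m by rewrite subnK.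
have jE : j = i.+1%:Z - (2 * n)%:Z - 2 - t%:Z by [].
by rewrite ltn_add2r; lia.
Qed.

(** After sorting, such a monomial already has the target form. *)
Lemma reduce_small ks : lower_degree_reduces (size ks) ->
  all (fun k => k <= 2 * n)%N ks -> monomials_reduce ks.
Proof.
move=> hr h hk; move: (hk).
have hp : perm_eq ks (expseq (2 * n) (fun j => count_mem j ks)).
  by apply: perm_expseq_count; apply/allP => x hx; rewrite (allP hk) // (allP h).
apply: (monomials_reduce_perm hr hp) => _ v k hv k0.
exists (umon Y u (expseq (2 * n) (fun j => count_mem j ks)) (Y v (- k%:Z) vac)).
rewrite subrr; split; last exact: (On0 HV).
apply: inspan_gen; exists (fun j => count_mem j ks), v, k.
by rewrite om_umon.
Qed.

(* Applying [L(-1) + L(0)] to [u_{-2n} u_s w] produces [u_{-2n-1} u_s w] with a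
   positive integer coefficient, from every factor [u_{-2n}]. *)
Lemma reduce_top s : lower_degree_reduces (size s).+1 ->
  (forall l, size l = (size s).+1 -> (sumn l < (2 * n).+1 + sumn s)%N ->
     monomials_reduce l) ->
  (forall l, size l = (size s).+1 -> sumn l = ((2 * n).+1 + sumn s)%N ->
     (count_mem (2 * n).+1 l <= count_mem (2 * n).+1 s)%N -> monomials_reduce l) ->
  all (fun k => k <= (2 * n).+1)%N s -> monomials_reduce ((2 * n).+1 :: s).
Proof.
move=> hr hs hc sle s1 v k hv k0; set w := Y v _ vac.
have s0 : all (fun k => 0 < k)%N s by [].
have n2 : (0 < 2 * n)%N by rewrite muln_gt0.
(* The monomial to be translated. Its index sum is one less than that of the goal, so it reduces by
   [hs], also with $k+1$ in place of $k$. *)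
pose s' := (2 * n)%N :: s.
have s'0 : all (fun k => 0 < k)%N s' by rewrite /= n2.
have [[wv hwv] _] := HW hv.
have hw : homog Y omega w (wv + k%:Z - 1) := homog_creation HK HV k hwv.
have := On_OL n (OL_translate Y omega (umon Y u s' w)).
rewrite (homog_umon HK HV Hu s' hw) (translation_umon HK HV).
rewrite (translate_creation HK HV) (umonZ HV).
move/reducible_On => h.
have rs' v1 k1 : W v1 -> (0 < k1)%N -> reducible (umon Y u s' (Y v1 (- k1%:Z) vac)).
  by move=> hv1 hk1; apply: (hs s').
set c := \sum_(k0 <- s') _ in h.
set X := \sum_(i < size s') _ in h.
have {h} hX : reducible X.
  rewrite -[X](addKr (k%:R *: umon Y u s' (Y v (- k%:Z - 1) vac))) addrC.
  have -> : - k%:Z - 1 = - k.+1%:Z by lia.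
  apply: reducibleB; last exact/reducibleZ/rs'.
  rewrite -[_ + X](addrK ((wv + k%:Z - 1 + c)%:~R *: umon Y u s' w)).
  apply: reducibleB; last exact/reducibleZ/rs'.
  by move: h; have -> : - k%:Z - 1 = - k.+1%:Z by lia.
(* Coefficient with which position $i$ contributes the goal monomial; the sum is positive because
   the head of [s'] is $2n$. *)
pose g (i : 'I_(size s')) := (if nth 0%N s' i == (2 * n)%N then (2 * n)%N else 0%N).
apply: (@reducible_cancel (\sum_i g i)%N%:R _ X) => //.
  move/pcharf0P: HK => ->; rewrite -lt0n.
  by rewrite big_ord_recl /g /= eqxx addn_gt0 n2.
rewrite natr_sum scaler_suml -sumrB.
have hi (i : 'I_(size s')) : reducible
    ((nth 0%N s' i)%:R *: umon Y u (incr_nth s' i) w - (g i)%:R *: umon Y u ((2 * n).+1 :: s) w).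
  have hp := perm_incr_nth (ltn_ord i).
  have sz : size (incr_nth s' i) = (size s).+1 by rewrite size_incr_nth ltn_ord.
  have pos : all (fun k => 0 < k)%N (incr_nth s' i).
    rewrite (perm_all _ hp); apply/allP => x.
    by rewrite inE => /orP[/eqP->//|/mem_rem]; apply: (allP s'0).
  have xs : nth 0%N s' i \in s' by rewrite mem_nth.
  have sm : sumn (incr_nth s' i) = ((2 * n).+1 + sumn s)%N.
    have sumn_cons a l : sumn (a :: l) = (a + sumn l)%N by [].
    have := perm_sumn (perm_to_rem xs); rewrite (perm_sumn hp) !sumn_cons; lia.
  rewrite /g; case: eqP => [E|/eqP nE].
    rewrite E -scalerBr; apply: reducibleZ.
    move: hp; rewrite E /= eqxx => hp.
    apply: (reducible_Fr hr _ hv k0 ((permutable_W _ hv).1 _ _ hp)).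
    by rewrite sz.
  rewrite scale0r subr0; apply: reducibleZ.
  (* Raising $2n+1$ gives an index $2n+2$, which [reduce_large] removes. *)
  have [E|nE1] := eqVneq (nth 0%N s' i) (2 * n).+1.
    apply: (monomials_reduce_perm _ hp); rewrite ?sz //.
    have sr : (size (rem (nth 0%N s' i) s')).+1 = (size s).+1.
      by rewrite -sz (perm_size hp).
    apply: reduce_large; rewrite ?sr //; last by rewrite E; lia.
    move=> l hl hl'; apply: hs => //.
    by rewrite (leq_trans hl') // -sm (perm_sumn hp).
  (* Raising any other index creates no new $u_{-2n-1}$, so the number of these stays at most that
     of [s]. *)
  apply: hc => //.
  move/permP: hp => /(_ (pred1 (2 * n).+1)) ->.
  have count_cons a l : count_mem (2 * n).+1 (a :: l)
    = ((a == (2 * n).+1) + count_mem (2 * n).+1 l)%N by [].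
  rewrite count_cons eqSS (negbTE nE) add0n count_rem (leq_trans (leq_subr _ _)) //.
  by rewrite count_cons ltn_eqF.
elim/big_ind: _ => //; first exact: reducible0.
exact: reducibleD.
Qed.

Lemma all_monomials_reduce ks : monomials_reduce ks.
Proof.
(* Three nested strong inductions realize the lexicographic order. *)
have [r] := ubnP (size ks); elim: r ks => // r IHr ks.
have [T] := ubnP (sumn ks); elim: T ks => // T IHT ks.
have [c] := ubnP (count_mem (2 * n).+1 ks); elim: c ks => // c IHc ks hc hT hr.
have lower : lower_degree_reduces (size ks).
  by move=> l hl; apply: IHr; apply: leq_trans hl _.
have lowT l : size l = size ks -> (sumn l < sumn ks)%N -> monomials_reduce l.
  by move=> hl lt; apply: IHT; rewrite ?hl //; apply: leq_trans lt _.
(* Indices from $2n+2$ on go first, since [reduce_top] requires the other factors to have index at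
   most $2n+1$. *)
case: (boolP (has (fun m => 2 * n + 2 <= m)%N ks)) => [/hasP[m mk hm]|/hasPn hle].
  have hp := perm_to_rem mk; have sz := perm_size hp.
  apply: (monomials_reduce_perm lower hp).
  apply: reduce_large => // [|l hl]; first by rewrite -[_.+1]sz.
  by rewrite -[(m + _)%N](perm_sumn hp); apply: lowT; rewrite hl sz.
case: (boolP ((2 * n).+1 \in ks)) => [mk|mk].
  have hp := perm_to_rem mk; have sz := perm_size hp.
  apply: (monomials_reduce_perm lower hp).
  apply: reduce_top => // [|l hl|l hl|].
  - by rewrite -[_.+1]sz.
  - by rewrite -[(_ + _)%N](perm_sumn hp); apply: lowT; rewrite hl sz.
  - rewrite -[(_ + sumn _)%N](perm_sumn hp) => hsm hcl; apply: IHc.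
    + apply: leq_ltn_trans hcl _; rewrite -ltnS; apply: leq_trans hc.
      by move/permP: hp => ->; rewrite /= eqxx.
    + by rewrite hsm.
    + by rewrite hl -/(size ((2 * n).+1 :: rem (2 * n).+1 ks)) -sz.
  - by apply/allP => x /mem_rem /hle; lia.
apply: reduce_small => //; apply/allP => x hx; have := hle x hx.
have : x != (2 * n).+1 by apply: contraNneq mk => <-.
by lia.
Qed.

End Reduction.

(** * Generators of $A_n^u$, and the relation of part (3) *)

Section MainParts.
Set Implicit Arguments.
Unset Strict Implicit.
Variables (K : fieldType) (HK : [pchar K] =i pred0).
Variables (V : lmodType K) (Y : V -> int -> V -> V) (vac omega : V) (cc : K).
Hypothesis HV : isVOA Y vac omega cc.
Variables (n : nat) (u : V) (wu : int).
Hypotheses (Hn : (0 < n)%N) (Hu : homog Y omega u wu) (Hwu : - n%:Z <= wu).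
Hypothesis Hperm : perm_prop Y vac u (Vgen Y vac u).

Lemma gen_alg_mono (S T : V -> Prop) x :
  (forall y, S y -> gen_alg Y omega n T y) ->
  gen_alg Y omega n S x -> gen_alg Y omega n T x.
Proof.
move=> ST; elim=> [y /ST //|y hy|c y z _ hy _ hz|a b y _ ha _ hb h].
- exact: ga_On.
- exact: ga_lin.
- exact: ga_mul ha hb h.
Qed.

Lemma gen_alg_span (S : V -> Prop) x : inspan (gen_alg Y omega n S) x -> gen_alg Y omega n S x.
Proof.
move=> hx; apply: (inspan_ind hx); first exact/ga_On/(On0 HV).
by move=> c y z; apply: ga_lin.
Qed.

(** Already as a vector space, $V^u$ lies in the span of the ordered monomials plus $O_n(V)$. *)
Lemma gen_alg_low x :
  gen_alg Y omega n (Vgen Y vac u) x <->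
  gen_alg Y omega n (fun y => exists e, y = om Y u (2 * n) e vac) x.
Proof.
split; apply: gen_alg_mono => y; last first.
  case=> e ->; apply: ga_gen; rewrite om_umon.
  exact/Vgen_umon/all_expseq.
move=> hy; apply: gen_alg_span; apply: inspanS hy => z [ks [hks ->]].
(* The reduction is applied with $W=\{\mathbf 1\}$. *)
have HW v : v = vac -> (exists wv, homog Y omega v wv) /\ (forall j, 0 <= j -> Y u j v = 0).
  move=> ->; split; first by exists 0; rewrite /homog (Lop_vac HV) // scale0r.
  exact: (creation0 HV).
have := all_monomials_reduce HK HV Hu Hwu Hn Hperm HW hks (erefl vac) (ltn0Sn 0).
rewrite (creation1 HV) => -[t [ht hOn]].
rewrite -(subrK t (umon _ _ _ _)) -[_ - t]scale1r; apply: ga_lin; first exact: ga_On.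
apply: gen_alg_span; apply: inspanS ht => _ [e [_ [k [-> [_ ->]]]]].
(* $\mathbf 1_{-k}\mathbf 1$ is $\mathbf 1$ for $k=1$ and zero otherwise. *)
rewrite (vacuum_id HV); case: ifP => _; first by apply: ga_gen; exists e.
apply: ga_On; rewrite om_umon -[0](scale0r 0) (umonZ HV) scale0r; exact: (On0 HV).
Qed.

(** Apply $L(-1)+L(0)$ to $Mv_{-k}\mathbf 1$ and solve for the term in which a factor $u_{-2n}$ is
    raised; its coefficient is $2n(i_{2n}+1)$. *)
Lemma top_exponent_relation v wv k (i : nat -> nat) (p : nat) :
  homog Y omega v wv -> (forall j, 0 <= j -> Y u j v = 0) -> (0 < p)%N ->
  let w := Y v (- k%:Z) vac in
  let i' := fun j => if j == (2 * n).+1 then p else i j in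
  let e := fun j => if j == (2 * n).+1 then (p - 1)%N
                    else if j == (2 * n)%N then (i j).+1 else i j in
  let e2 := fun j => if j == (2 * n).+1 then (p - 2)%N else e j in
  let el := fun (l : nat) j => if j == l.+1 then (e j).+1
                               else if j == l then (e j).-1 else e j in
  let NN := (\sum_(1 <= j < (2 * n).+2) i' j)%N in
  let D := fun x => \sum_(1 <= j < (absz (n%:Z + wu)).+1)
              ('C(absz (n%:Z + wu), j.-1))%:R *: Y u (wu - n%:Z - j%:Z - 1) x in
  let A := (wv + k%:Z - 1 - 1)%:~R
           + \sum_(1 <= j < (2 * n).+2) (i' j)%:R * (wu + j%:Z - 1)%:~R in
  exists f : V,
    Fr Y u NN.-1 w f /\
    ((forall (j j' : nat) (x : V), (0 < j)%N -> (0 < j')%N ->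
        Y u (- j%:Z) (Y u (- j'%:Z) x) = Y u (- j'%:Z) (Y u (- j%:Z) x)) -> f = 0) /\
    On Y omega n
      (om Y u (2 * n).+1 i' w
       - (- (1 / ((2 * n * (i (2 * n)%N).+1)%N)%:R)) *:
           (A *: om Y u (2 * n).+1 e w
            - ((2 * n).+1 * (p - 1))%N%:R *: D (om Y u (2 * n).+1 e2 w)
            + \sum_(1 <= l < 2 * n) (l * i l)%N%:R *: om Y u (2 * n).+1 (el l) w
            + k%:R *: om Y u (2 * n).+1 e (Y v (- k%:Z - 1) vac)
            + f)).
Proof.
move=> hv uv p0 w i' e e2 el NN D A.
have := Ocirc_top HK Hu Hwu (om Y u (2 * n).+1 e2 w); rewrite -/(D _) => hD.
have m0 : (0 < 2 * n)%N by rewrite muln_gt0.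
move: (2 * n)%N m0 @i' @e @e2 @el @NN @A hD => m m0 i' e e2 el NN A hD.
have em : e m = (i m).+1 by rewrite /e ltn_eqF // eqxx.
have em1 : e m.+1 = p.-1 by rewrite /e eqxx subn1.
have i'm : i' m = i m by rewrite /i' ltn_eqF.
have i'm1 : i' m.+1 = p by rewrite /i' eqxx.
have elow l : (l < m)%N -> e l = i l /\ i' l = i l.
  by move=> lm; rewrite /e /i' !ltn_eqF // ltnW.
(* [translation_om] wants the exponent of [u_{-2n-2}] to vanish, which the
   arbitrary function [i] need not satisfy. *)
pose e0 j := if j == m.+2 then 0%N else e j.
have e0E j : (j <= m.+1)%N -> e0 j = e j by move=> h; rewrite /e0 ltn_eqF.
have omE x : om Y u m.+1 e0 x = om Y u m.+1 e x.
  by apply: eq_om => j /andP[_ /e0E].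
have e0m : e0 m.+2 = 0%N by rewrite /e0 eqxx.
have [f [hf [fc fE]]] :=
  translation_om HK HV e0m (permutable_mode HK HV (- k%:Z) Hperm uv).
exists f; split; last split=> //.
  (* $M$ has the same length $N$ as the left-hand monomial: one factor $u_{-2n-1}$ has become
     $u_{-2n}$. *)
  rewrite (_ : NN = \sum_(1 <= l < m.+2) e0 l)%N //.
  rewrite /NN !(@big_nat_recr _ _ _ m.+1) ?(@big_nat_recr _ _ _ m) //= !e0E //.
  rewrite em em1 i'm i'm1 -(prednK p0) /= -!addnA addSnnS; congr (_ + _)%N.
  apply: eq_big_nat => l /andP[_ lm].
  by rewrite e0E; [have [-> ->] := elow l lm | rewrite ltnW // ltnW].
have := OL_translate Y omega (om Y u m.+1 e0 w).
have hw := homog_creation HK HV k hv; rewrite -/w in hw.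
rewrite {2}om_umon (homog_umon HK HV Hu _ hw) -om_umon fE omE omE (translate_creation HK HV).
have umE x : om Y u m.+1 e (k%:R *: x) = k%:R *: om Y u m.+1 e x.
  by rewrite !om_umon (umonZ HV).
rewrite umE sum_expseq.
have -> : (wv + k%:Z - 1 + \sum_(1 <= l < m.+2) (wu + l%:Z - 1) *+ e0 l)%:~R = A.
  (* That exchange lowers the weight by one, which explains the extra $-1$ in [A]. *)
  have -> : A = (wv + k%:Z - 1 - 1 + \sum_(1 <= l < m.+2) (wu + l%:Z - 1) *+ i' l)%:~R.
    rewrite rmorphD rmorph_sum; congr (_ + _); apply: eq_bigr => l _.
    by rewrite rmorphMn /= mulr_natl.
  congr (_%:~R).
  rewrite !(@big_nat_recr _ _ _ m.+1) ?(@big_nat_recr _ _ _ m) //= !e0E //.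
  rewrite em em1 i'm i'm1 -{2}(prednK p0) !mulrS.
  rewrite (@eq_big_nat _ _ _ 1%N m _ (fun l => (wu + l%:Z - 1) *+ i' l)) => [|l /andP[_ lm]].
    by move: (\sum_(1 <= l < m) _) (_ *+ i m) (_ *+ p.-1) => a b c; lia.
  by rewrite e0E; [have [-> ->] := elow l lm | rewrite ltnW // ltnW].
(* Raising $l<2n$ yields $M^{(l)}$, raising $2n$ yields the left-hand monomial, and raising $2n+1$
   puts $u_{-2n-2}$ in front. For $p=1$ the truncated [p - 2] is harmless, as its coefficient
   vanishes. *)
have -> : \sum_(1 <= l < m.+2) (l * e0 l)%:R *: om Y u m.+2 (raise l e0) w
  = \sum_(1 <= l < m) (l * i l)%:R *: om Y u m.+1 (el l) w
    + (m * (i m).+1)%:R *: om Y u m.+1 i' w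
    + (m.+1 * (p - 1))%:R *: Y u (- m.+2%:Z) (om Y u m.+1 e2 w).
  have omS x (e3 : nat -> nat) : om Y u m.+2 e3 x
      = iter (e3 m.+2) (Y u (- m.+2%:Z)) (om Y u m.+1 e3 x) by [].
  rewrite !(@big_nat_recr _ _ _ m.+1) ?(@big_nat_recr _ _ _ m) //= !e0E //.
  rewrite em em1 -subn1; congr (_ + _ + _).
  - apply: eq_big_nat => l /andP[_ lm]; rewrite e0E; last by rewrite ltnW // ltnW.
    have [-> _] := elow l lm; congr (_ *: _); rewrite -omS omS.
    have -> : raise l e0 m.+2 = 0%N.
      by rewrite /raise e0m !gtn_eqF // ltnS ltnW // ltnW.
    by apply: eq_om => j /andP[_ jm]; rewrite /raise e0E.
  - congr (_ *: _); rewrite -omS omS.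
    have -> : raise m e0 m.+2 = 0%N by rewrite /raise e0m !gtn_eqF.
    apply: eq_om => j /andP[_ jm]; rewrite /raise e0E // /i'.
    case: eqP => [->|/eqP jm1]; first by rewrite em1 prednK.
    case: eqP => [->|/eqP jm0]; first by rewrite em.
    by rewrite /e (negbTE jm1) (negbTE jm0).
  - congr (_ *: _); rewrite -omS omS.
    have -> : raise m.+1 e0 m.+2 = 1%N by rewrite /raise eqxx e0m.
    congr (Y u _ _).
    apply: eq_om => j /andP[_ jm]; rewrite /raise e0E // /e2 ltn_eqF //.
    by case: eqP => // ->; rewrite em1; lia.
set S := \sum_(1 <= l < m) _; set X := om Y u m.+1 i' w; set M := om Y u m.+1 e w.
set M1 := om Y u m.+1 e _; set b := om Y u m.+1 e2 w in hD *.
set c := (m * (i m).+1)%N; set q := (m.+1 * (p - 1))%:R => hOL.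
have c0 : c%:R != 0 :> K by move/pcharf0P: HK => ->; rewrite -lt0n muln_gt0 m0.
(* Subtracting [q] times the relation $u_{-2n-2}b+Db\in O_n(V)$ trades $u_{-2n-2}$ for $-D$;
   division by [c] follows. *)
have := On_lin HV (- q) (On_Ocirc HV hD) (On_OL n hOL).
move/(On_lin HV c%:R^-1)/(_ (On0 HV n)); rewrite addr0.
move=> /(eq_ind _ (On Y omega n)) h; apply: h; apply/esym; rewrite div1r scaleNr opprK.
have {1}-> : X = c%:R^-1 *: (c%:R *: X) by rewrite scalerA mulVf // scale1r.
rewrite -scalerDr; congr (_ *: _).
rewrite scalerDr !scaleNr.
move: (k%:R *: M1) (c%:R *: X) (q *: Y u _ _) (q *: D b) (A *: M) => z1 z2 z3 z4 z5.
by rewrite [RHS](AC (2*((1*3*1)*1)) ((5*(8*2*4*3*7))*(6*1))) /= subrr addr0.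
Qed.

End MainParts.

Theorem theorem3p8 (K : fieldType) (HK : [pchar K] =i pred0)
  (V : lmodType K) (Y : V -> int -> V -> V) (vac omega : V) (cc : K)
  (HV : isVOA Y vac omega cc)
  (n : nat) (Hn : (0 < n)%N)
  (u : V) (wu : int) (Hu : homog Y omega u wu) (Hwu : - (n%:Z) <= wu)
  (Hsub : vsubalg Y vac u)
  (Hperm : perm_prop Y vac u (Vgen Y vac u))
  (W : V -> Prop) (HWh : forall v, W v -> exists wv, homog Y omega v wv)
  (Hstrong : acts_strongly Y vac u W) :
  (* (1) *)
  ((forall x, gen_alg Y omega n (Vgen Y vac u) x <->
              gen_alg Y omega n (fun y => exists e, y = om Y u (2 * n) e vac) x)
   /\
   (forall (ks : seq nat) (v : V), all (fun k => 0 < k)%N ks -> W v ->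
      exists z, inspan (fun y => exists e v' (k : nat), W v' /\ (0 < k)%N /\
                          y = om Y u (2 * n) e (Y v' (- k%:Z) vac)) z
                /\ On Y omega n (umon Y u ks v - z)))
  /\
  (* (2) *)
  (forall (v : V) (wv : int) (k : nat), W v -> homog Y omega v wv -> (0 < k)%N ->
     OL Y omega
       (Y u (- (2 * n + 1)%:Z) (Y v (- k%:Z) vac)
        - (- ((wu + wv + (2 * n)%:Z + k%:Z - 2)%:~R / (2 * n)%:R)
              *: Y u (- (2 * n)%:Z) (Y v (- k%:Z) vac)
           - (k%:R / (2 * n)%:R) *: Y u (- (2 * n)%:Z) (Y v (- k%:Z - 1) vac))))
  /\
  (* (3) *)
  (forall (v : V) (wv : int) (k : nat) (i : nat -> nat) (p : nat),
     W v -> homog Y omega v wv -> (0 < k)%N -> (0 < p)%N ->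
     let w := Y v (- k%:Z) vac in
     (* exponents i_1, ..., i_{2n}, i_{2n+1} = p *)
     let i' := fun j => if j == (2 * n).+1 then p else i j in
     (* M = u_{-2n-1}^{p-1} u_{-2n}^{i_{2n}+1} u_{-2n+1}^{i_{2n-1}} ... u_{-1}^{i_1} *)
     let e := fun j => if j == (2 * n).+1 then (p - 1)%N
                       else if j == 2 * n then (i j).+1 else i j in
     (* u_{-2n-1}^{p-2} u_{-2n}^{i_{2n}+1} ... u_{-1}^{i_1} *)
     let e2 := fun j => if j == (2 * n).+1 then (p - 2)%N else e j in
     (* M^(l) *)
     let el := fun (l : nat) j => if j == l.+1 then (e j).+1
                                  else if j == l then (e j).-1 else e j in
     let NN := (\sum_(1 <= j < (2 * n).+2) i' j)%N in
     let D := fun x => \sum_(1 <= j < (absz (n%:Z + wu)).+1)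
                 ('C(absz (n%:Z + wu), j.-1))%:R *: Y u (wu - n%:Z - j%:Z - 1) x in
     let A := (wv + k%:Z - 1 - 1)%:~R
              + \sum_(1 <= j < (2 * n).+2) (i' j)%:R * (wu + j%:Z - 1)%:~R in
     exists f : V,
       Fr Y u NN.-1 w f /\
       ((forall (j j' : nat) (x : V), (0 < j)%N -> (0 < j')%N ->
           Y u (- j%:Z) (Y u (- j'%:Z) x) = Y u (- j'%:Z) (Y u (- j%:Z) x)) -> f = 0) /\
       On Y omega n
         (om Y u (2 * n).+1 i' w
          - (- (1 / ((2 * n * (i (2 * n)).+1)%N)%:R)) *:
              (A *: om Y u (2 * n).+1 e w
               - ((2 * n).+1 * (p - 1))%N%:R *: D (om Y u (2 * n).+1 e2 w)
               + \sum_(1 <= l < 2 * n) (l * i l)%N%:R *: om Y u (2 * n).+1 (el l) w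
               + k%:R *: om Y u (2 * n).+1 e (Y v (- k%:Z - 1) vac)
               + f))).

Proof.
have HWu v : W v -> forall j, 0 <= j -> Y u j v = 0.
  by move=> hv j; apply: Hstrong.2 => //; apply: (Vgen_self HV).
have HW v : W v ->
    (exists wv, homog Y omega v wv) /\ (forall j, 0 <= j -> Y u j v = 0).
  by move=> hv; split; [apply: HWh | apply: HWu].
split; [split|split].
- exact: (gen_alg_low HK HV Hn Hu Hwu Hperm).
(* The case $k=1$, since $v=v_{-1}\mathbf 1$. *)
- move=> ks v hks hv; have := all_monomials_reduce HK HV Hu Hwu Hn Hperm HW hks hv (ltn0Sn 0).
  by rewrite (creation1 HV).
- move=> v wv k _ hv _; apply: (OL_translate_sub HK HV Hu _ hv) => //.
  by rewrite muln_eq0 -lt0n.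
- move=> v wv k i p hv hwv _ p0.
  exact: (top_exponent_relation HK HV Hn Hu Hwu Hperm k i hwv (HWu v hv) p0).
Qed.
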